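(* For every $0<\gamma<1$, \[ \max_{0<t<1}(1-t)\theta(t^{\gamma})>\Gamma_{\chi}\sqrt{\frac{1}{\gamma}}, \] where $\theta(t)=\sum_{j=1}^{\infty}t^{\binom{j}{2}}=1+t+t^3+t^6+\cdots$ and $\Gamma_{\chi}=\sqrt{\frac{\pi}{2}}\max_{0<u<\infty}\frac{1-e^{-u}}{\sqrt{u}}=0.7998308498\dots$. *)

(* Defs.v *)
From HB Require Import structures.
From mathcomp Require Import all_boot all_order all_algebra.
From mathcomp Require Import all_classical all_reals all_analysis.
Set Implicit Arguments.
Unset Strict Implicit.
Unset Printing Implicit Defensive.
Import Order.TTheory GRing.Theory Num.Theory.
Import numFieldNormedType.Exports.
Local Open Scope classical_set_scope.
Local Open Scope ring_scope.

Definition is_maximum (R : realType) (A : set R) (M : R) : Prop :=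
  A M /\ ubound A M.

Definition has_maximum (R : realType) (A : set R) : Prop :=
  exists M : R, is_maximum A M.

(* Equal to 0 when A has no greatest element, so a claim about [maximum A]
   should come with [has_maximum A]. *)
Definition maximum (R : realType) (A : set R) : R := xget 0 (is_maximum A).

Definition theta (R : realType) (t : R) : R :=
  \big[+%R/0]_(1 <= j <oo) t ^+ 'C(j, 2).

Definition theta_values (R : realType) (gamma : R) : set R :=
  [set (1 - t) * theta (t `^ gamma) | t in `]0, 1[].

Definition chi_values (R : realType) : set R :=
  [set (1 - expR (- u)) / Num.sqrt u | u in `]0, +oo[].
Arguments chi_values R : clear implicits.

Definition Gamma_chi (R : realType) : R :=
  Num.sqrt (pi / 2) * maximum (chi_values R).

(* The number 0.d1d2...dk in base ten. It is computed digit by digit because a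
   ten-digit numerator n%:R would be a unary natural number. *)
Definition decimal (R : realType) (ds : seq nat) : R :=
  foldr (fun d x => (d%:R + x) / 10%:R) 0 ds.

(* Main.v *)
From Stdlib Require BinInt QArith_base Lia.
Require Import Defs.
From HB Require Import structures.
From mathcomp Require Import all_boot all_order all_algebra.
From mathcomp Require Import all_classical all_reals all_analysis.
From mathcomp Require Import ring lra.
Set Implicit Arguments.
Unset Strict Implicit.
Unset Printing Implicit Defensive.
Import Order.TTheory GRing.Theory Num.Theory.
Import numFieldNormedType.Exports.
Local Open Scope classical_set_scope.
Local Open Scope ring_scope.

(** Substituting t = exp(-u) and writing a = gamma u / 2, the quantity to be
maximised is (1 - exp(-u)) S(a) with S(a) = sum_(n >= 0) exp(-a n (n + 1)).
Taking u to be the maximiser of (1 - exp(-u)) / sqrt u, the strict inequality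
reduces to S(a) > (1/2) sqrt (pi / a), i.e. sqrt a * S(a) exceeds the Gauss
integral of exp(-x^2) over [0, +oo[. With h = sqrt a and
B n = exp(-a n (n + 1)), the integral over [n h, (n + 1) h] is less than
h (3/4 B n + 1/8 B (n - 1) + 1/8 B (n + 1)); the second differences telescope,
and the boundary term at n = 0 vanishes because B (-1) = B 0.

The maximiser satisfies exp u = 1 + 2 u, so that
Gamma_chi = sqrt (2 pi u) / (1 + 2 u), and the ten digits follow from enclosures
of u and pi / 2 by partial sums of the exponential and cosine series. *)

(** * Exact arithmetic on binary fractions, carried into the reals *)

Local Notation Z := BinNums.Z.
Local Notation Zpos := BinNums.Zpos.
Local Notation Zadd := BinInt.Z.add.
Local Notation Zmul := BinInt.Z.mul.
Local Notation Zopp := BinInt.Z.opp.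
Local Notation Q := QArith_base.Q.
Local Notation Qnum := QArith_base.Qnum.
Local Notation Qden := QArith_base.Qden.
Local Notation Qadd := QArith_base.Qplus.
Local Notation Qmul := QArith_base.Qmult.
Local Notation Qopp := QArith_base.Qopp.
Local Notation Qle_bool := QArith_base.Qle_bool.
Local Notation natQ n := (QArith_base.inject_Z (BinInt.Z.of_nat n)).
Local Notation invQ p := (QArith_base.Qmake (Zpos BinNums.xH) p).

(* Numerals of a realType are unary; numerical inequalities are therefore
   decided on binary fractions and transported along [ratQ]. *)
Definition ratZ (R : realType) (z : Z) : R :=
  match z with
  | BinNums.Z0 => 0
  | Zpos p => (BinPos.Pos.to_nat p)%:R
  | BinNums.Zneg p => - (BinPos.Pos.to_nat p)%:R
  end.
Arguments ratZ R z : clear implicits.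

Definition ratQ (R : realType) (q : Q) : R :=
  ratZ R (Qnum q) / ratZ R (Zpos (Qden q)).
Arguments ratQ R q : clear implicits.

Section ratQ_theory.
Variable R : realType.
Local Notation zr := (ratZ R).

(** As a difference of two truncated naturals, an integer is additive without a case analysis on
    signs. *)
Let zrE z : zr z =
  (BinInt.Z.to_nat z)%:R - (BinInt.Z.to_nat (Zopp z))%:R.
Proof. by case: z => [|p|p] /=; rewrite ?subr0 ?sub0r. Qed.

Let zrD x y : zr (Zadd x y) = zr x + zr y.
Proof.
rewrite !zrE addrACA -opprD -!natrD; apply/eqP.
rewrite subr_eq addrAC eq_sym subr_eq -!natrD; apply/eqP; congr _%:R.
rewrite -!plusE; Lia.lia.
Qed.

Let zrM x y : zr (Zmul x y) = zr x * zr y.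
Proof.
by case: x y => [|p|p] [|q|q] /=;
  rewrite ?(mul0r, mulr0)// Pnat.Pos2Nat.inj_mul multE natrM
          ?(mulrN, mulNr, opprK).
Qed.

Let zrN x : zr (Zopp x) = - zr x.
Proof. by case: x => [|p|p] /=; rewrite ?oppr0 ?opprK. Qed.

Let zr_nat n : zr (BinInt.Z.of_nat n) = n%:R.
Proof. by case: n => //= n; rewrite Pnat.SuccNat2Pos.id_succ. Qed.

Let le_zr x y : BinInt.Z.le x y -> zr x <= zr y.
Proof.
move=> xy; have -> : y = Zadd x
    (BinInt.Z.of_nat (BinInt.Z.to_nat (BinInt.Z.sub y x))).
  by rewrite Znat.Z2Nat.id; Lia.lia.
by rewrite zrD zr_nat lerDl.
Qed.

Let zr_gt0 p : 0 < zr (Zpos p).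
Proof.
rewrite (lt_le_trans (@ltr01 R))//.
apply: (@le_zr (Zpos BinNums.xH) (Zpos p)); Lia.lia.
Qed.

Let zr_neq0 p : zr (Zpos p) != 0.
Proof. by rewrite gt_eqF. Qed.

Let zr_posM p q :
  zr (Zpos (BinPos.Pos.mul p q)) = zr (Zpos p) * zr (Zpos q).
Proof. by rewrite -zrM. Qed.

Lemma ratQD p q : ratQ R (Qadd p q) = ratQ R p + ratQ R q.
Proof. by rewrite /ratQ zrD !zrM zr_posM addf_div. Qed.

Lemma ratQM p q : ratQ R (Qmul p q) = ratQ R p * ratQ R q.
Proof. by rewrite /ratQ zrM zr_posM mulf_div. Qed.

Lemma ratQN p : ratQ R (Qopp p) = - ratQ R p.
Proof. by rewrite /ratQ /= zrN mulNr. Qed.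

Lemma ratQ_nat n : ratQ R (natQ n) = n%:R.
Proof. by rewrite /ratQ /= divr1 zr_nat. Qed.

Lemma ratQ_inv p : ratQ R (invQ p) = (ratQ R (QArith_base.inject_Z (Zpos p)))^-1.
Proof. by rewrite /ratQ /= divr1 mul1r. Qed.

Lemma ratQ_le p q : Qle_bool p q -> ratQ R p <= ratQ R q.
Proof.
rewrite /Qle_bool => /BinInt.Z.leb_le pq.
rewrite ler_pdivrMr// mulrAC ler_pdivlMr//.
by rewrite -!zrM le_zr.
Qed.

Lemma ratQ_lt p q : ~~ Qle_bool q p -> ratQ R p < ratQ R q.
Proof.
rewrite /Qle_bool => /negbTE/BinInt.Z.leb_gt/BinInt.Z.le_succ_l/le_zr.
rewrite -BinInt.Z.add_1_r zrD !zrM => pq.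
rewrite ltr_pdivrMr// mulrAC ltr_pdivlMr//.
by apply: lt_le_trans pq; rewrite ltrDl; exact: (zr_gt0 BinNums.xH).
Qed.

End ratQ_theory.

(** * Rational enclosures from partial sums of the exponential and cosine series *)

Section hypergeometric_series.
Variable R : realType.

(* The exponential series is [d i = i] at [y = x], the cosine series is
   [d i = (2i+1)(2i+2) - 1] at [y = - x^2]. *)
Definition hyperterm (d : nat -> nat) (y : R) n :=
  \prod_(i < n) (y / (d i).+1%:R).

(** Horner evaluation from the front: the factor [y / (d k + 1)] is common to all terms but the
    first, and the remaining bracket is the same kind of sum for [d] shifted by one. *)
Fixpoint hypersumQ (d : nat -> nat) (y : Q) n k : Q :=
  if n is m.+1 then
    Qadd (natQ 1) (Qmul (Qmul y (invQ (BinPos.Pos.of_succ_nat (d k))))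
                        (hypersumQ d y m k.+1))
  else natQ 0.

Lemma hypertermS d y n :
  hyperterm d y n.+1 = hyperterm d y n * (y / (d n).+1%:R).
Proof. by rewrite /hyperterm big_ord_recr. Qed.

Lemma ratQ_hypersumQ d y n :
  ratQ R (hypersumQ d y n 0) = \sum_(0 <= i < n) hyperterm d (ratQ R y) i.
Proof.
(* Each Horner step passes to a tail of the series, so the induction must range over all shifts
   [k]. *)
suff H k : ratQ R (hypersumQ d y n k) =
    \sum_(0 <= i < n) hyperterm (fun j => d (k + j)%N) (ratQ R y) i by rewrite H.
elim: n k => [|n IHn] k /=; first by rewrite big_geq// (ratQ_nat R 0).
rewrite big_nat_recl//= ratQD 2!ratQM ratQ_inv (ratQ_nat R 1).
rewrite (ratQ_nat R (d k).+1) IHn mulr_sumr; congr (_ + _).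
  by rewrite /hyperterm big_ord0.
apply: eq_bigr => i _; rewrite /hyperterm big_ord_recl /= addn0.
by congr (_ * _); apply: eq_bigr => j _; rewrite /bump/= addnS.
Qed.

Lemma hyperterm_even_gt0 d (y : R) n : y < 0 -> 0 < hyperterm d y n.*2.
Proof.
move=> y0; elim: n => [|n IHn]; first by rewrite /hyperterm big_ord0.
rewrite doubleS !hypertermS -mulrA mulr_gt0// nmulr_lgt0 pmulr_llt0//;
  by rewrite invr_gt0.
Qed.

(** The term ratio lies strictly between -1 and 0, so the pair has the sign of its first member. *)
Lemma hyperterm_pair_gt0 d (y : R) n : y < 0 -> - y < (d n.*2).+1%:R ->
  0 < hyperterm d y n.*2 + hyperterm d y n.*2.+1.
Proof.
move=> y0 yd; rewrite hypertermS -[X in X + _]mulr1 -mulrDr mulr_gt0//.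
  exact: hyperterm_even_gt0.
by rewrite -ltrBlDl sub0r ltrNl -mulNr ltr_pdivrMr// mul1r.
Qed.

Lemma hyperterm_pair_lt0 d (y : R) n : y < 0 -> - y < (d n.*2.+1).+1%:R ->
  hyperterm d y n.*2.+1 + hyperterm d y n.*2.+2 < 0.
Proof.
move=> y0 yd; rewrite (hypertermS d y n.*2.+1) -[X in X + _]mulr1 -mulrDr.
rewrite nmulr_rlt0.
  by rewrite -ltrBlDl sub0r ltrNl -mulNr ltr_pdivrMr// mul1r.
by rewrite hypertermS pmulr_rlt0 ?hyperterm_even_gt0// pmulr_llt0// invr_gt0.
Qed.

(** Leibniz estimate: beyond the truncation point the terms are grouped into pairs, all of them
    positive. *)
Lemma hypersum_even_lt d (y : R) n : y < 0 ->
  (forall i : nat, (n.*2 <= i)%N -> - y < (d i).+1%:R) ->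
  cvgn (series (hyperterm d y)) ->
  \sum_(0 <= i < n.*2) hyperterm d y i < limn (series (hyperterm d y)).
Proof.
move=> y0 yd cv; apply: lt_sum_lim_series => // k.
rewrite addnS -doubleD; apply: hyperterm_pair_gt0 => //.
by apply: yd; rewrite leq_double leq_addr.
Qed.

Lemma hypersum_odd_gt d (y : R) n : y < 0 ->
  (forall i : nat, (n.*2 <= i)%N -> - y < (d i).+1%:R) ->
  cvgn (series (hyperterm d y)) ->
  limn (series (hyperterm d y)) < \sum_(0 <= i < n.*2.+1) hyperterm d y i.
Proof.
move=> y0 yd cv; rewrite -ltrN2 -sumrN -lim_seriesN//.
apply: lt_sum_lim_series => [|k]; first by rewrite is_cvg_seriesN.
rewrite /= addnS addSn -doubleD -opprD oppr_gt0; apply: hyperterm_pair_lt0 => //.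
by apply: yd; rewrite leqW// leq_double leq_addr.
Qed.

Lemma exp_hyperterm : @exp_coeff R = hyperterm id :> (R -> R^nat).
Proof.
apply/funext => x; apply/funext; elim=> [|n IHn].
  by rewrite /exp_coeff /= /hyperterm big_ord0 divr1.
rewrite hypertermS -IHn /exp_coeff /= exprSr factS natrM invfM.
ring.
Qed.

Lemma cos_hyperterm (x : R) :
  cos_coeff' x = hyperterm (fun i => (i.*2.+1 * i.*2.+2).-1)%N (- x ^+ 2).
Proof.
apply/funext; elim=> [|n IHn].
  by rewrite /cos_coeff' /= /hyperterm big_ord0 divr1 mulr1.
rewrite hypertermS -IHn /cos_coeff' prednK// doubleS !factS !natrM exprSz.
rewrite !exprS expr0 !invfM; ring.
Qed.

Lemma expR_ge_ratQ q n : 0 <= ratQ R q ->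
  ratQ R (hypersumQ id q n 0) <= expR (ratQ R q).
Proof.
move=> q0; rewrite ratQ_hypersumQ -exp_hyperterm.
apply: nondecreasing_cvgn_le; last exact: is_cvg_series_exp_coeff.
apply: nondecreasing_series => // i _ _; exact: exp_coeff_ge0.
Qed.

(** An upper bound on exp(q) comes from a lower bound on exp(-q), whose series alternates; the test
    [1 <= p S] avoids inverting the partial sum [S]. *)
Lemma expR_le_ratQ q p n : 0 < ratQ R q < n.*2.+1%:R -> 0 < ratQ R p ->
  1 <= ratQ R (Qmul p (hypersumQ id (Qopp q) n.*2 0)) ->
  expR (ratQ R q) <= ratQ R p.
Proof.
move=> /andP[q0 qn] p0; rewrite ratQM -ler_pdivrMl// mulr1 ratQ_hypersumQ => pS.
rewrite -[leRHS]invrK -[leLHS]invrK -expRN lef_pV2 ?posrE ?invr_gt0 ?expR_gt0//.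
apply: (le_trans pS); rewrite ratQN /expR exp_hyperterm ltW//.
apply: hypersum_even_lt.
- by rewrite oppr_lt0.
- move=> i ni; rewrite opprK (lt_le_trans qn)// ler_nat; exact: ni.
- rewrite -exp_hyperterm; exact: is_cvg_series_exp_coeff.
Qed.

Let cosd i := (i.*2.+1 * i.*2.+2).-1%N.

Lemma cos_ge_ratQ q n : 0 < ratQ R q -> ratQ R q ^+ 2 < n.*2.+1%:R ->
  ratQ R (hypersumQ cosd (Qopp (Qmul q q)) n.*2 0)
    <= cos (ratQ R q).
Proof.
move=> q0 qn; rewrite ratQ_hypersumQ ratQN ratQM -expr2.
have cc := @cvg_cos_coeff' R (ratQ R q).
rewrite -(cvg_lim (@Rhausdorff R) cc) cos_hyperterm ltW//.
apply: hypersum_even_lt.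
- by rewrite oppr_lt0 exprn_gt0.
- move=> i ni; rewrite opprK (lt_le_trans qn)// ler_nat prednK//.
  by rewrite (leq_trans _ (leq_pmulr _ _))// !ltnS (leq_trans ni)// -addnn leq_addr.
- by rewrite -cos_hyperterm; apply/cvg_ex; eexists; exact: cc.
Qed.

Lemma cos_le_ratQ q n : 0 < ratQ R q -> ratQ R q ^+ 2 < n.*2.+1%:R ->
  cos (ratQ R q) <=
  ratQ R (hypersumQ cosd (Qopp (Qmul q q)) n.*2.+1 0).
Proof.
move=> q0 qn; rewrite ratQ_hypersumQ ratQN ratQM -expr2.
have cc := @cvg_cos_coeff' R (ratQ R q).
rewrite -(cvg_lim (@Rhausdorff R) cc) cos_hyperterm ltW//.
apply: hypersum_odd_gt.
- by rewrite oppr_lt0 exprn_gt0.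
- move=> i ni; rewrite opprK (lt_le_trans qn)// ler_nat prednK//.
  by rewrite (leq_trans _ (leq_pmulr _ _))// !ltnS (leq_trans ni)// -addnn leq_addr.
- by rewrite -cos_hyperterm; apply/cvg_ex; eexists; exact: cc.
Qed.

End hypergeometric_series.

(** * Numerical enclosures of pi / 2, the critical point and Gamma_chi *)

Definition decimalQ (ds : seq nat) : Q :=
  foldr (fun d x => Qmul
      (Qadd (natQ d) x)
      (invQ (BinPos.Pos.of_succ_nat 9)))
    (natQ 0) ds.

Lemma ratQ0 (R : realType) : ratQ R (natQ 0) = 0.
Proof. exact: ratQ_nat. Qed.

Lemma ratQ1 (R : realType) : ratQ R (natQ 1) = 1.
Proof. exact: ratQ_nat. Qed.

(* Unfolding [ratQ] at a concrete fraction would expand unary numerals. *)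
Local Opaque ratQ.

Section numerics.
Variable R : realType.
Local Notation "p ⊕ q" := (Qadd p q) (at level 50, left associativity).
Local Notation "p ⊗ q" := (Qmul p q) (at level 40, left associativity).

Lemma ratQ_decimalQ ds : ratQ R (decimalQ ds) = decimal R ds.
Proof.
elim: ds => [|d ds IH] /=; first exact: ratQ0.
by rewrite ratQM ratQD (ratQ_nat R d) IH ratQ_inv (ratQ_nat R 10).
Qed.

(** Eleven decimals of [pi / 2] and of the critical point suffice to fix ten decimals of
    [Gamma_chi]. *)
Definition pihalf_lo :=
  natQ 1 ⊕ decimalQ [:: 5; 7; 0; 7; 9; 6; 3; 2; 6; 7; 9]%N.
Definition pihalf_hi :=
  natQ 1 ⊕ decimalQ [:: 5; 7; 0; 7; 9; 6; 3; 2; 6; 8; 0]%N.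
Definition crit_lo :=
  natQ 1 ⊕ decimalQ [:: 2; 5; 6; 4; 3; 1; 2; 0; 8; 6; 2]%N.
Definition crit_hi :=
  natQ 1 ⊕ decimalQ [:: 2; 5; 6; 4; 3; 1; 2; 0; 8; 6; 3]%N.

(** Cosine decreases strictly on [0, pi] and vanishes at [pi / 2], so a nonnegative lower bound for
    the cosine of the candidate settles its position. *)
Lemma pihalf_ge : ratQ R pihalf_lo <= pi / 2.
Proof.
rewrite leNgt; apply/negP => lt_lo.
have lo_le2 : ratQ R pihalf_lo <= 2.
  by rewrite -(ratQ_nat R 2); apply: ratQ_le; vm_compute.
have : cos (ratQ R pihalf_lo) < cos (pi / 2).
  have pi0 := @pi_ge0 R; have pi2 := @pi_ge2 R.
  by rewrite ltr_cos// in_itv/=; lra.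
rewrite cos_pihalf ltNge => /negP; apply.
apply: (le_trans _ (@cos_ge_ratQ R pihalf_lo 6 _ _)).
- by rewrite -(ratQ0 R); apply: ratQ_le; vm_compute.
- by rewrite -(ratQ0 R); apply: ratQ_lt; vm_compute.
- by rewrite -(ratQ_nat R 13) expr2 -ratQM; apply: ratQ_lt; vm_compute.
Qed.

Lemma pihalf_le : pi / 2 <= ratQ R pihalf_hi.
Proof.
rewrite leNgt; apply/negP => lt_hi.
have hi_gt0 : 0 < ratQ R pihalf_hi.
  by rewrite -(ratQ0 R); apply: ratQ_lt; vm_compute.
have : cos (pi / 2) < cos (ratQ R pihalf_hi).
  have pi0 := @pi_ge0 R.
  by rewrite ltr_cos// in_itv/=; lra.
rewrite cos_pihalf ltNge => /negP; apply.
apply: le_trans (@cos_le_ratQ R pihalf_hi 6 _ _) _ => //.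
- by rewrite -(ratQ_nat R 13) expr2 -ratQM; apply: ratQ_lt; vm_compute.
- by rewrite -(ratQ0 R); apply: ratQ_le; vm_compute.
Qed.

Let h (u : R) := expR u - 2 * u.

Let continuous_h : continuous h.
Proof.
move=> x; apply: cvgB; first exact: continuous_expR.
by apply: cvgM; [exact: cvg_cst|exact: cvg_id].
Qed.

Let crit_between (a b : R) : a <= b -> h a <= 1 -> 1 <= h b ->
  exists2 u : R, a <= u <= b & expR u = 1 + 2 * u.
Proof.
move=> ab ha hb; have [||u] := @IVT R h a b 1 ab.
- exact/continuous_subspaceT/continuous_h.
- by rewrite ge_min ha le_max hb orbT.
rewrite in_itv/= => u_itv hu; exists u => //.
by move: hu; rewrite /h => /eqP; rewrite subr_eq => /eqP.
Qed.

(** The function [expR u - 2 * u] is at most 1 at [crit_lo] and at least 1 at [crit_hi], so it takes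
    the value 1 in between. *)
Lemma crit_exists : exists2 u : R,
  ratQ R crit_lo <= u <= ratQ R crit_hi & expR u = 1 + 2 * u.
Proof.
apply: crit_between.
- by apply: ratQ_le; vm_compute.
- rewrite lerBlDr -(ratQ_nat R 2) -(ratQ1 R) -ratQM -ratQD.
  apply: (@expR_le_ratQ R _ _ 9).
  - apply/andP; split.
      by rewrite -(ratQ0 R); apply: ratQ_lt; vm_compute.
    by rewrite -(ratQ_nat R 19); apply: ratQ_lt; vm_compute.
  - by rewrite -(ratQ0 R); apply: ratQ_lt; vm_compute.
  - by rewrite -(ratQ1 R); apply: ratQ_le; vm_compute.
- rewrite lerBrDr; apply: (le_trans _ (@expR_ge_ratQ R crit_hi 16 _)); last first.
    by rewrite -(ratQ0 R); apply: ratQ_le; vm_compute.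
  rewrite -(ratQ_nat R 2) -(ratQ1 R) -ratQM -ratQD.
  by apply: ratQ_le; vm_compute.
Qed.

(** Squaring removes the root; then each side takes its worst endpoint, [b] in the affine factor and
    [p], [a] under the root, which leaves a test on rationals. *)
Let sqrt_ge_of_bounds (d p a b P u : R) : 0 <= d -> 0 <= p -> 0 <= a ->
  p <= P -> a <= u <= b -> (d * (1 + 2 * b)) ^+ 2 <= 4 * p * a ->
  d * (1 + 2 * u) <= Num.sqrt (4 * P * u).
Proof.
move=> d0 p0 a0 pP /andP[au ub] dpa.
have du0 : 0 <= d * (1 + 2 * u) by rewrite mulr_ge0//; lra.
rewrite -(ger0_norm du0) -sqrtr_sqr ler_sqrt; last by rewrite !mulr_ge0//; lra.
apply: (@le_trans _ _ ((d * (1 + 2 * b)) ^+ 2)).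
  rewrite ler_pXn2r// ?nnegrE//; last by rewrite mulr_ge0//; lra.
  by rewrite ler_wpM2l//; lra.
apply: (le_trans dpa); rewrite ler_pM// ?mulr_ge0//; lra.
Qed.

Let sqrt_lt_of_bounds (d p a b P u : R) : 0 < d -> 0 <= P -> 0 <= a ->
  P <= p -> a <= u <= b -> 4 * p * b < (d * (1 + 2 * a)) ^+ 2 ->
  Num.sqrt (4 * P * u) < d * (1 + 2 * u).
Proof.
move=> d0 P0 a0 Pp /andP[au ub] dpa.
have du0 : 0 < d * (1 + 2 * u) by rewrite mulr_gt0//; lra.
rewrite -(ger0_norm (ltW du0)) -sqrtr_sqr ltr_sqrt ?exprn_gt0//.
apply: (@lt_le_trans _ _ ((d * (1 + 2 * a)) ^+ 2)); last first.
  rewrite ler_pXn2r// ?nnegrE ?(ltW du0)//; last by rewrite mulr_ge0//; lra.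
  by rewrite ler_pM2l//; lra.
apply: le_lt_trans dpa; rewrite ler_pM// ?mulr_ge0//; lra.
Qed.

Let ratQ_4mul p a : 4 * ratQ R p * ratQ R a = ratQ R (natQ 4 ⊗ p ⊗ a).
Proof. by rewrite 2!ratQM ratQ_nat. Qed.

Let ratQ_sqr_affine d a : (ratQ R d * (1 + 2 * ratQ R a)) ^+ 2 =
  ratQ R ((d ⊗ (natQ 1 ⊕ natQ 2 ⊗ a)) ⊗ (d ⊗ (natQ 1 ⊕ natQ 2 ⊗ a))).
Proof. by rewrite expr2 2!ratQM ratQD ratQM ratQ1 ratQ_nat. Qed.

Lemma crit_Gamma_lo u : ratQ R crit_lo <= u <= ratQ R crit_hi ->
  decimal R [:: 7; 9; 9; 8; 3; 0; 8; 4; 9; 8]%N * (1 + 2 * u) <=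
  Num.sqrt (4 * (pi / 2) * u).
Proof.
rewrite -ratQ_decimalQ => u_itv.
apply: (sqrt_ge_of_bounds _ _ _ pihalf_ge u_itv).
- by rewrite -(ratQ0 R); apply: ratQ_le; vm_compute.
- by rewrite -(ratQ0 R); apply: ratQ_le; vm_compute.
- by rewrite -(ratQ0 R); apply: ratQ_le; vm_compute.
by rewrite ratQ_4mul ratQ_sqr_affine; apply: ratQ_le; vm_compute.
Qed.

Lemma crit_Gamma_hi u : ratQ R crit_lo <= u <= ratQ R crit_hi ->
  Num.sqrt (4 * (pi / 2) * u) <
  decimal R [:: 7; 9; 9; 8; 3; 0; 8; 4; 9; 9]%N * (1 + 2 * u).
Proof.
rewrite -ratQ_decimalQ => u_itv.
apply: (sqrt_lt_of_bounds _ _ _ pihalf_le u_itv).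
- by rewrite -(ratQ0 R); apply: ratQ_lt; vm_compute.
- by rewrite divr_ge0// pi_ge0.
- by rewrite -(ratQ0 R); apply: ratQ_le; vm_compute.
by rewrite ratQ_4mul ratQ_sqr_affine; apply: ratQ_lt; vm_compute.
Qed.

Lemma crit_gt0 u : ratQ R crit_lo <= u <= ratQ R crit_hi -> 0 < u.
Proof.
move=> /andP[lo _]; apply: lt_le_trans lo.
by rewrite -(ratQ0 R); apply: ratQ_lt; vm_compute.
Qed.

Lemma critical_point : exists u : R, [/\ 0 < u, expR u = 1 + 2 * u &
  decimal R [:: 7; 9; 9; 8; 3; 0; 8; 4; 9; 8]%N * (1 + 2 * u) <=
    Num.sqrt (4 * (pi / 2) * u) <
  decimal R [:: 7; 9; 9; 8; 3; 0; 8; 4; 9; 9]%N * (1 + 2 * u)].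
Proof.
have [u u_itv expR_u] := crit_exists; exists u; split => //.
  exact: crit_gt0 u_itv.
by apply/andP; split; [exact: crit_Gamma_lo u_itv|exact: crit_Gamma_hi u_itv].
Qed.

(** The constant matches the threshold [4 / 5] for [a]: beyond it [pi <= 4 * a], so sqrt(pi) / (2
    sqrt(a)) is at most 1. *)
Lemma pi_le : pi <= 16 / 5 :> R.
Proof.
have : ratQ R pihalf_hi <= ratQ R (natQ 1 ⊕ decimalQ [:: 6]%N).
  by apply: ratQ_le; vm_compute.
rewrite ratQD ratQ1 ratQ_decimalQ /decimal /= addr0 => /(le_trans pihalf_le).
lra.
Qed.

End numerics.

(** * Monotonicity from derivatives, a primitive of the Gaussian, chords of exp *)

Lemma derive_ge0_le (R : realType) (f df : R -> R) (a b : R) :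
  a <= b -> (forall x, a <= x <= b -> is_derive x 1 f (df x)) ->
  (forall x, a < x < b -> 0 <= df x) -> f a <= f b.
Proof.
rewrite le_eqVlt => /predU1P[->//|ab] fdf df0.
have fcont : {within `[a, b], continuous f}.
  by apply: derivable_within_continuous => x; rewrite in_itv/= => /fdf[].
have [x|c] := @MVT _ f df _ _ ab _ fcont.
  by rewrite in_itv/= => /andP[ax xb]; apply: fdf; rewrite !ltW.
rewrite in_itv/= -subr_ge0 => /df0 dfc ->.
by rewrite mulr_ge0// subr_ge0 ltW.
Qed.

Lemma gauss_primitive (R : realType) : exists E : R -> R,
  [/\ forall x : R, is_derive x 1 E (expR (- x ^+ 2)), E 0 = 0
    & E x @[x --> +oo] --> Num.sqrt pi / 2].
Proof.
pose mu := @lebesgue_measure R.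
pose F (x : R) := (\int[mu]_(t in `]-oo, x]) gauss_fun t)%R.
have intT := @integrableT_gauss R.
have intS (A : set R) : measurable A -> mu.-integrable A (EFin \o @gauss_fun R).
  by move=> mA; apply: integrableS intT.
(* Integrating from -oo makes the fundamental theorem applicable at every real point; subtracting
   [F 0] then normalises the primitive at 0. *)
exists (fun x => F x - F 0); split; last 1 first.
- have FE x : 0 < x -> F x - F 0 = gauss_integral_proof.integral0_gauss x.
    move=> x0; rewrite /F Rintegral_itvB//; first last.
    + by rewrite bnd_simp ltW.
    + exact: intS.
    by rewrite Rintegral_itv_obnd_cbnd//; exact: intS.
  apply: cvg_trans.
    apply: near_eq_cvg; near=> x.
    by rewrite /= FE//.
  (* The known limit is that of the square, pi / 4; nonnegativity of the integral allows the root to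
     be taken. *)
  have : Num.sqrt (@gauss_integral_proof.integral0_gauss R x ^+ 2) @[x --> +oo]
      --> Num.sqrt (pi / 4).
    apply: continuous_cvg; first exact: sqrt_continuous.
    exact: gauss_integral_proof.cvg_integral0_gauss_sqr.
  rewrite sqrtrM ?pi_ge0// sqrtrV// (_ : 4 = 2 ^+ 2); last first.
    by rewrite expr2 -natrM.
  rewrite sqrtr_sqr ger0_norm//.
  apply: cvg_trans; apply: near_eq_cvg; near=> x.
  rewrite sqrtr_sqr ger0_norm//; exact: gauss_integral_proof.integral0_gauss_ge0.
- move=> x; rewrite -[expR _]subr0; apply: is_deriveB.
  have [||||dF dFE] := @continuous_FTC1 R (@gauss_fun R) (BInfty _ true) x (x + 1).
  + by rewrite ltrDl.
  + exact: intS.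
  + by rewrite ltNyr.
  + exact: continuous_gauss_fun.
  by apply: DeriveDef => //; rewrite -derive1E dFE.
- by rewrite subrr.
Unshelve. all: by end_near. Qed.

Lemma expR_chord (R : realType) (z l : R) : 0 <= l <= 1 ->
  expR (l * z) <= 1 + l * (expR z - 1).
Proof.
move=> /andP[l0 l1]; have := convex_expR (Itv01 l0 l1) (z : R^o) (0 : R^o).
rewrite !convRE /= expR0 mulr0 addr0 mulr1 => /le_trans; apply.
rewrite /unstable.onem; lra.
Qed.

(** * Convergence of theta and elementary bounds by its partial sums *)

Section theta_partial_sums.
Variable R : realType.
Implicit Types q : R.

Let tri q j := q ^+ 'C(j.+1, 2).

Lemma theta_shift q n : \sum_(1 <= j < n.+1) q ^+ 'C(j, 2) = series (tri q) n.
Proof. by rewrite /series /= big_add1. Qed.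

Lemma theta_partial_cvg q : 0 <= q < 1 ->
  (fun n => \sum_(1 <= j < n) q ^+ 'C(j, 2)) @ \oo --> theta q.
Proof.
move=> /andP[q0 q1].
suff : cvgn (series (tri q)).
  move=> cv; rewrite /theta.
  suff -> : limn (fun n => \sum_(1 <= j < n) q ^+ 'C(j, 2)) =
    limn (series (tri q)).
    by rewrite -cvg_shiftS; under eq_fun do rewrite theta_shift.
  apply/cvg_lim => //; rewrite -cvg_shiftS.
  by under eq_fun do rewrite theta_shift.
(* Domination by the geometric series holds because C(n+1, 2) = C(n, 2) + n is at least n. *)
apply: (@series_le_cvg _ _ (geometric 1 q)).
- by move=> n; rewrite /tri exprn_ge0.
- by move=> n; rewrite /geometric/= mul1r exprn_ge0.
- move=> n; rewrite /geometric/= mul1r /tri.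
  apply: ler_wiXn2l => //; first exact: ltW.
  by rewrite binS bin1 leq_addl.
- by apply: is_cvg_geometric_series; rewrite ger0_norm.
Qed.

Lemma theta_ge_partial q n : 0 <= q < 1 ->
  \sum_(j < n) q ^+ 'C(j.+1, 2) <= theta q.
Proof.
move=> q01; rewrite -(cvg_lim (@Rhausdorff R) (theta_partial_cvg q01)).
have -> : \sum_(j < n) q ^+ 'C(j.+1, 2) = \sum_(1 <= j < n.+1) q ^+ 'C(j, 2).
  by rewrite big_add1 big_mkord.
apply: (@nondecreasing_cvgn_le _ (fun n => \sum_(1 <= j < n) q ^+ 'C(j, 2))).
  apply/nondecreasing_seqP => -[|k]; first by rewrite !big_geq.
  by rewrite [leRHS]big_nat_recr//= lerDl exprn_ge0//; case/andP : q01.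
by apply/cvg_ex; eexists; exact: theta_partial_cvg.
Qed.

Lemma theta_le_bound q M : 0 <= q < 1 ->
  (forall n, \sum_(j < n) q ^+ 'C(j.+1, 2) <= M) -> theta q <= M.
Proof.
move=> q01 SM; rewrite -(cvg_lim (@Rhausdorff R) (theta_partial_cvg q01)).
apply: limr_le; first by apply/cvg_ex; eexists; exact: theta_partial_cvg.
near=> n; have /prednK <- : (0 < n)%N by near: n; exists 1%N.
by rewrite big_add1 big_mkord.
Unshelve. all: by end_near. Qed.

Lemma theta_gt1 q : 0 < q < 1 -> 1 + q <= theta q.
Proof.
move=> /andP[q0 q1]; apply: le_trans (theta_ge_partial 2 _); last by rewrite ltW.
by rewrite !big_ord_recr big_ord0 /= add0r.
Qed.

Lemma theta_le_geometric q : 0 <= q < 1 -> theta q <= (1 - q)^-1.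
Proof.
move=> /[dup] q01 /andP[q0 q1]; apply: theta_le_bound => // n.
rewrite -[leRHS]div1r ler_pdivlMr ?subr_gt0//.
apply: (@le_trans _ _ ((\sum_(j < n) q ^+ j) * (1 - q))).
  apply: ler_wpM2r; first by rewrite subr_ge0 ltW.
  apply: ler_sum => j _.
  apply: ler_wiXn2l => //; first exact: ltW.
  by rewrite binS bin1 leq_addl.
rewrite mulrC -opprB mulNr -subrX1 opprB.
by rewrite gerBl exprn_ge0.
Qed.

End theta_partial_sums.

(** * The maximum of (1 - exp(-u)) / sqrt u *)

Section chi_maximum.
Variables (R : realType) (u0 : R).
Hypotheses (u0_gt0 : 0 < u0) (expR_u0 : expR u0 = 1 + 2 * u0).

Let expR_le_below (u : R) : 0 < u <= u0 -> expR u <= 1 + 2 * u.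
Proof.
move=> /andP[u_gt0 uu0]; have : 0 <= u / u0 <= 1.
  by rewrite divr_ge0 ?(ltW u_gt0) ?(ltW u0_gt0)//= ler_pdivrMr// mul1r.
move=> /(expR_chord u0); rewrite divfK ?gt_eqF// expR_u0 => /le_trans; apply.
by rewrite le_eqVlt; apply/orP; left; apply/eqP; field; rewrite gt_eqF.
Qed.

Let expR_ge_above (u : R) : u0 <= u -> 1 + 2 * u <= expR u.
Proof.
move=> uu0; have u_gt0 : 0 < u by exact: lt_le_trans uu0.
have : 0 <= u0 / u <= 1.
  by rewrite divr_ge0 ?(ltW u_gt0) ?(ltW u0_gt0)//= ler_pdivrMr// mul1r.
move=> /(expR_chord u); rewrite divfK ?gt_eqF// expR_u0 lerD2l.
move=> /(ler_wpM2r (ltW u_gt0)).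
have -> : u0 / u * (expR u - 1) * u = u0 * (expR u - 1).
  by field; rewrite gt_eqF.
by rewrite [2 * u0]mulrC -mulrA ler_pM2l//; lra.
Qed.

(** The square of the function to be maximised, free of the root; for [u > 0] its derivative [dk]
    has the sign of [1 + 2 * u - expR u]. *)
Let k (u : R) := (1 - expR (- u)) * (1 - expR (- u)) * u^-1.

Let dk (u : R) := (1 - expR (- u)) * expR (- u) * (1 + 2 * u - expR u) / u ^+ 2.

Let is_derive_k (u : R) : 0 < u -> is_derive u 1 k (dk u).
Proof.
move=> u_gt0.
have dV : is_derive u 1 (fun x : R => x^-1) (- u ^- 2 *: 1).
  by apply: is_deriveV; rewrite gt_eqF.
have dE : is_derive u 1 (fun x : R => expR (- x)) (expR (- u) * -1).
  exact: (@is_derive1_comp R expR (fun x => - x)).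
have dB := is_deriveB (is_derive_cst (1 : R) u 1) dE.
have dS := is_deriveM dB dB.
have dM := is_deriveM dS dV.
have dk_raw : is_derive u 1 k _ := dM.
apply: (is_derive_eq dk_raw).
rewrite /dk /GRing.scale /=.
have -> : expR u = (expR (- u))^-1 by rewrite expRN invrK.
have -> : ((cst 1 - (fun x : R => expR (- x))) *
           (cst 1 - (fun x : R => expR (- x)))) u =
  (1 - expR (- u)) * (1 - expR (- u)) by [].
have -> : (cst 1 - (fun x : R => expR (- x))) u = 1 - expR (- u) by [].
by field; rewrite !gt_eqF// expR_gt0.
Qed.

Let one_sub_expRN_gt0 (u : R) : 0 < u -> 0 < 1 - expR (- u).
Proof. by move=> u_gt0; rewrite subr_gt0 expR_lt1 oppr_lt0. Qed.

Let k_le (u : R) : 0 < u -> k u <= k u0.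
Proof.
move=> u_gt0; have [uu0|/ltW u0u] := leP u u0.
- apply: (@derive_ge0_le R k dk u u0 uu0) => x /andP[ux xu0].
    by apply: is_derive_k; exact: lt_le_trans ux.
  have x_gt0 : 0 < x by exact: lt_trans ux.
  rewrite divr_ge0 ?sqr_ge0// !mulr_ge0 ?expR_ge0 ?(ltW (one_sub_expRN_gt0 _))//.
  by rewrite subr_ge0 expR_le_below// x_gt0 ltW.
- rewrite -lerN2.
  apply: (@derive_ge0_le R (fun x => - k x) (fun x => - dk x) u0 u u0u)
    => x /andP[ux xu0].
    by apply: is_deriveN; apply: is_derive_k; exact: lt_le_trans ux.
  have x_gt0 : 0 < x by exact: lt_trans ux.
  rewrite oppr_ge0 mulr_le0_ge0 ?invr_ge0 ?sqr_ge0// mulr_ge0_le0//.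
    by rewrite mulr_ge0 ?expR_ge0 ?(ltW (one_sub_expRN_gt0 _)).
  by rewrite subr_le0 expR_ge_above// ltW.
Qed.

Lemma chi_maximum : is_maximum (chi_values R) ((1 - expR (- u0)) / Num.sqrt u0).
Proof.
split; first by exists u0 => //=; rewrite in_itv/= u0_gt0.
have chiE (u : R) : 0 < u -> (1 - expR (- u)) / Num.sqrt u = Num.sqrt (k u).
  move=> u_gt0; rewrite /k -expr2 sqrtrM ?sqr_ge0// sqrtr_sqr sqrtrV ?(ltW u_gt0)//.
  by rewrite gtr0_norm// one_sub_expRN_gt0.
move=> y [u]; rewrite /= in_itv/= andbT => u_gt0 <-.
rewrite !chiE// ler_wsqrtr//; exact: k_le.
Qed.

End chi_maximum.

Lemma is_maximum_unique (R : realType) (A : set R) (M N : R) :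
  is_maximum A M -> is_maximum A N -> M = N.
Proof.
by move=> [AM uM] [AN uN]; apply/eqP; rewrite eq_le uN//= uM.
Qed.

Lemma maximumE (R : realType) (A : set R) (M : R) :
  is_maximum A M -> maximum A = M.
Proof.
move=> AM; rewrite /maximum; case: xgetP => [N _ AN|/(_ M)//].
exact: is_maximum_unique AN AM.
Qed.

(** * Comparison of the Gauss integral with sums of exp(-a n (n + 1)) *)

Section gauss_step.
Variable R : realType.
Variable E : R -> R.
Hypothesis dE : forall x : R, is_derive x 1 E (expR (- x ^+ 2)).

(* The chord of the convex function exp bounds cosh (2 m s) on [0, h / 2]; the
   factor exp(-s^2) <= 1 is dropped. *)
Lemma gauss_midpoint (m h : R) : 0 <= m -> 0 < h ->
  E (m + h / 2) - E (m - h / 2) <=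
  h * expR (- m ^+ 2) * (1 + ((expR (m * h) + expR (- (m * h))) / 2 - 1) / 2).
Proof.
move=> m0 h0; pose D := (expR (m * h) + expR (- (m * h))) / 2 - 1.
(* Here [1 + D] is cosh(m h), and [G s] is the integral of the chord majorant minus that of the
   Gaussian over [m - s, m + s]; [G] grows from 0, and [G (h / 2) >= 0] is the claim. *)
pose G s := expR (- m ^+ 2) * (2 * s + 2 * D / h * s ^+ 2) -
  (E (m + s) - E (m - s)).
pose dG s := expR (- m ^+ 2) * (2 + 4 * D / h * s) -
  (expR (- (m + s) ^+ 2) + expR (- (m - s) ^+ 2)).
have dEp (s : R) : is_derive s 1 (fun s => E (m + s)) (expR (- (m + s) ^+ 2)).
  rewrite -[expR _]mulr1; apply: (@is_derive1_comp R E (fun s => m + s)).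
  by rewrite -[1 in X in is_derive _ _ _ X]add0r; apply: is_deriveD.
have dEm (s : R) : is_derive s 1 (fun s => E (m - s)) (- expR (- (m - s) ^+ 2)).
  rewrite -mulrN1; apply: (@is_derive1_comp R E (fun s => m - s)).
  by rewrite -[-1]add0r; apply: is_deriveB.
have dP (s : R) : is_derive s 1
    (expR (- m ^+ 2) \*: ((2 \*: id) + ((2 * D / h) \*: (fun s : R => s ^+ 2))))
    (expR (- m ^+ 2) * (2 + 4 * D / h * s)).
  apply: is_derive_eq.
  by rewrite /GRing.scale/=; field; rewrite gt_eqF.
have dGE (s : R) : is_derive s 1 G (dG s).
  apply: (is_derive_eq (is_deriveB (dP s) (is_deriveB (dEp s) (dEm s)))).
  by rewrite /dG opprK.
have dG0 s : 0 < s < h / 2 -> 0 <= dG s.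
  move=> /andP[s0 sh].
  have l01 : 0 <= 2 * s / h <= 1.
    apply/andP; split; first by rewrite divr_ge0// ?mulr_ge0// ltW.
    by rewrite ler_pdivrMr// mul1r; lra.
  have := expR_chord (m * h) l01; have := expR_chord (- (m * h)) l01.
  have -> : 2 * s / h * (m * h) = 2 * m * s by field; rewrite gt_eqF.
  have -> : 2 * s / h * - (m * h) = - (2 * m * s) by field; rewrite gt_eqF.
  move=> c1 c2; rewrite /dG subr_ge0.
  have e1 : expR (- (m + s) ^+ 2) <= expR (- m ^+ 2) * expR (- (2 * m * s)).
    by rewrite -expRD ler_expR; nra.
  have e2 : expR (- (m - s) ^+ 2) <= expR (- m ^+ 2) * expR (2 * m * s).
    by rewrite -expRD ler_expR; nra.
  apply: (le_trans (lerD e1 e2)); rewrite -mulrDr ler_wpM2l ?expR_ge0//.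
  apply: (le_trans (lerD c1 c2)); rewrite /D le_eqVlt; apply/orP; left; apply/eqP.
  by field; rewrite gt_eqF.
have := @derive_ge0_le R G dG 0 (h / 2) _ (fun s _ => dGE s) dG0.
rewrite ltW ?divr_gt0// => /(_ isT).
have -> : G 0 = 0.
  by rewrite /G addr0 subr0 subrr expr0n !mulr0 addr0 mulr0 subr0.
rewrite /G subr_ge0 => /le_trans; apply.
rewrite le_eqVlt; apply/orP; left; apply/eqP; rewrite -/D.
by field; rewrite gt_eqF.
Qed.

(** The term B x of the sum S(a), taken at real [x] so that the value at -1 is available and equals
    the value at 0. *)
Definition pronic_expR (a x : R) := expR (- (a * (x * (x + 1)))).

(** The tangent bound 1 - 3a/4 gives only 2/5 at [a = 4 / 5]; applied to the fourth root it gives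
    (17/20)^4 > 1/2. *)
Let expR_decay_ge_half (a : R) : 0 < a <= 4 / 5 -> 1 / 2 <= expR (- (3 * a / 4)).
Proof.
move=> /andP[a0 a1]; have -> : - (3 * a / 4) = 4%:R * - (3 * a / 16) by field.
rewrite expRM_natl; have := expR_ge1Dx (- (3 * a / 16)) => h1.
apply: (@le_trans _ _ ((1 - 3 / 20) ^+ 4)); first by lra.
by rewrite ler_pXn2r ?nnegrE ?expR_ge0//; lra.
Qed.

(* After division by exp(-m^2), m = (x + 1/2) sqrt a, and with y = a (x + 1/2),
   the constant term 3/4 e^(a/4) + 1/4 e^(-3a/4) exceeds 1 by AM-GM, and
   e^(-3a/4) >= 1/2 handles the coefficient of cosh y - 1. *)
Lemma gauss_second_difference (a x : R) : 0 < a <= 4 / 5 -> 0 <= x ->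
  E ((x + 1) * Num.sqrt a) - E (x * Num.sqrt a) <
  Num.sqrt a * (3 / 4 * pronic_expR a x + 1 / 8 * pronic_expR a (x - 1) +
                1 / 8 * pronic_expR a (x + 1)).
Proof.
move=> /[dup] a01 /andP[a0 a1] x0; set h := Num.sqrt a.
have h0 : 0 < h by rewrite sqrtr_gt0.
have hh : h ^+ 2 = a by rewrite sqr_sqrtr// ltW.
pose m := (x + 1 / 2) * h; pose p := expR (- m ^+ 2); pose y := a * (x + 1 / 2).
have m0 : 0 <= m by rewrite mulr_ge0 ?(ltW h0)//; lra.
have := gauss_midpoint m0 h0.
have -> : m + h / 2 = (x + 1) * h by rewrite /m; field.
have -> : m - h / 2 = x * h by rewrite /m; field.
have -> : m * h = y by rewrite /m /y -hh; ring.
move=> /le_lt_trans; apply; rewrite -/p -mulrA ltr_pM2l//.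
have p0 : 0 < p := expR_gt0 _.
have mm : m ^+ 2 = a * (x + 1 / 2) ^+ 2 by rewrite exprMn hh mulrC.
have -> : pronic_expR a x = p * expR (a / 4) by rewrite -expRD mm; congr expR; field.
have -> : pronic_expR a (x - 1) = p * (expR (- (3 * a / 4)) * expR y ^+ 2).
  by rewrite -expRM_natl -!expRD mm; congr expR; rewrite /y; field.
have -> : pronic_expR a (x + 1) = p * (expR (- (3 * a / 4)) * expR (- y) ^+ 2).
  by rewrite -expRM_natl -!expRD mm; congr expR; rewrite /y; field.
have ww : expR y * expR (- y) = 1 by rewrite -expRD subrr expR0.
have e1 : 1 + a / 4 < expR (a / 4) by rewrite expR_gt1Dx// gt_eqF// divr_gt0.
have e3 := expR_ge1Dx (- (3 * a / 4)).
have e3h := expR_decay_ge_half a01.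
have w0 : 0 < expR y := expR_gt0 _.
have w'0 : 0 < expR (- y) := expR_gt0 _.
have C1 : 2 <= expR y + expR (- y).
  by have := expR_ge1Dx y; have := expR_ge1Dx (- y); lra.
move: C1 ww e1 e3 e3h w0 w'0; set w := expR y; set w' := expR (- y).
set e := expR (a / 4); set k := expR _ => C1 ww e1 e3 e3h w0 w'0.
rewrite [ltRHS](_ : _ = p * (3 / 4 * e + k / 8 * (w ^+ 2 + w' ^+ 2))); last by field.
rewrite ltr_pM2l//.
have sq : w ^+ 2 + w' ^+ 2 = (w + w') ^+ 2 - 2 by rewrite sqrrD ww; ring.
(* With c = w + w', the difference of the two sides is (c - 2)^2; the rest is then linear in c -
   2. *)
have sq_ge : 2 + 4 * (w + w' - 2) <= w ^+ 2 + w' ^+ 2.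
  by rewrite sq; have := sqr_ge0 (w + w' - 2); rewrite !expr2; nra.
apply: (@lt_le_trans _ _ (3 / 4 * e + k / 8 * (2 + 4 * (w + w' - 2)))).
  have : (1 / 2) * (w + w' - 2) <= k * (w + w' - 2) by rewrite ler_wpM2r//; lra.
  lra.
by rewrite lerD2l ler_wpM2l//; lra.
Qed.

Let pronic_decr a (n : nat) : 0 < a -> pronic_expR a n.+1%:R <= pronic_expR a n%:R.
Proof.
move=> a0; rewrite ler_expR lerN2 ler_pM2l// -natr1.
have := ler0n R n; nra.
Qed.

Hypothesis E0 : E 0 = 0.
Hypothesis Ey : E x @[x --> +oo] --> Num.sqrt pi / 2.

(** The gap [d] of the first step is kept for every [n], so that strictness survives the passage to
    the limit. *)
Lemma gauss_sum_lower (a : R) : 0 < a <= 4 / 5 -> exists2 d : R, 0 < d &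
  forall n : nat, E (n.+1%:R * Num.sqrt a) + d <=
    Num.sqrt a * \sum_(j < n.+1) pronic_expR a j%:R.
Proof.
move=> /[dup] a01 /andP[a0 a1].
have B0 : pronic_expR a (0 - 1) = pronic_expR a 0.
  by rewrite /pronic_expR; congr expR; ring.
pose d := Num.sqrt a *
    (pronic_expR a 0 + (pronic_expR a 1 - pronic_expR a 0) / 8) -
  E (Num.sqrt a).
exists d.
  have := gauss_second_difference a01 (lexx 0).
  rewrite B0 add0r mul1r mul0r E0 subr0 => /lt_le_trans; rewrite subr_gt0; apply.
  by rewrite le_eqVlt; apply/orP; left; apply/eqP; field.
move=> n.
(* The induction carries the remaining end of the telescoped second differences, which is
   nonpositive since the terms decrease. *)
apply: (@le_trans _ _ (Num.sqrt a * (\sum_(j < n.+1) pronic_expR a j%:R +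
    (pronic_expR a n.+1%:R - pronic_expR a n%:R) / 8))); last first.
  by rewrite ler_wpM2l ?sqrtr_ge0// gerDl; have := pronic_decr n a0; lra.
elim: n => [|n IH].
  by rewrite big_ord_recr big_ord0 /= add0r mul1r /d addrC subrK.
have := gauss_second_difference a01 (ler0n R n.+1).
have -> : n.+1%:R - 1 = n%:R :> R by rewrite -natr1 addrK.
rewrite natr1 big_ord_recr /= => /ltW.
move: IH; lra.
Qed.

End gauss_step.

(** * Theta at exp(-x): monotonicity and continuity in x *)

Lemma pronic_bin j : (2 * 'C(j.+1, 2) = j * j.+1)%N.
Proof. by elim: j => // j IH; rewrite binS bin1 mulnDr IH; ring. Qed.

Section theta_exponential.
Variable R : realType.
Implicit Types a x y : R.

Let tri (j : nat) : R := 'C(j.+1, 2)%:R.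

Lemma expRN_in01 x : 0 < x -> 0 < expR (- x) < 1.
Proof. by move=> x0; rewrite expR_gt0 expR_lt1 oppr_lt0. Qed.

Let expRN_co01 x : 0 < x -> 0 <= expR (- x) < 1.
Proof. by move=> /expRN_in01/andP[/ltW -> ->]. Qed.

Let expRX x j : expR (- x) ^+ 'C(j.+1, 2) = expR (- (x * tri j)).
Proof. by rewrite -expRM_natr mulNr. Qed.

Lemma expRX_pronic a j : expR (- (2 * a)) ^+ 'C(j.+1, 2) = pronic_expR a j%:R.
Proof.
rewrite expRX /pronic_expR; congr (expR (- _)).
by rewrite natr1 -natrM -pronic_bin natrM /tri; ring.
Qed.

Lemma theta_expR_partial x n : 0 < x ->
  \sum_(j < n) expR (- (x * tri j)) <= theta (expR (- x)).
Proof.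
move=> x0; under eq_bigr do rewrite -expRX.
exact/theta_ge_partial/expRN_co01.
Qed.

Lemma theta_expR_bound x M : 0 < x ->
  (forall n, \sum_(j < n) expR (- (x * tri j)) <= M) -> theta (expR (- x)) <= M.
Proof.
move=> x0 SM; apply: theta_le_bound => [|n]; first exact: expRN_co01.
by under eq_bigr do rewrite expRX.
Qed.

Lemma theta_expR_anti x y : 0 < x -> x <= y ->
  theta (expR (- y)) <= theta (expR (- x)).
Proof.
move=> x0 xy; apply: theta_expR_bound => [|n]; first exact: lt_le_trans xy.
apply: le_trans (theta_expR_partial n x0); apply: ler_sum => j _.
by rewrite ler_expR lerN2 ler_wpM2r.
Qed.

(** Termwise, exp(-x t) - exp(-y t) <= (y - x) t exp(-x t); half of the exponent absorbs the factor
    t through t exp(-x t / 2) <= 2 / x. *)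
Lemma theta_expR_lipschitz x y : 0 < x -> x <= y ->
  theta (expR (- x)) - theta (expR (- y)) <=
  (y - x) * (2 / x * theta (expR (- (x / 2)))).
Proof.
move=> x0 xy; have y0 : 0 < y by exact: lt_le_trans xy.
have x20 : 0 < x / 2 by rewrite divr_gt0.
rewrite lerBlDl; apply: theta_expR_bound => // n.
apply: (@le_trans _ _ (\sum_(j < n) expR (- (y * tri j)) +
   (y - x) * (2 / x * \sum_(j < n) expR (- (x / 2 * tri j))))); last first.
  rewrite lerD ?theta_expR_partial// ler_wpM2l ?subr_ge0//.
  by rewrite ler_wpM2l ?theta_expR_partial// divr_ge0// ltW.
rewrite !mulr_sumr -big_split/=; apply: ler_sum => j _.
have t0 : 0 <= tri j by exact: ler0n.
set t := tri j in t0 *.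
pose e := expR (- (x / 2 * t)).
have e0 : 0 < e := expR_gt0 _.
have ex : expR (- (x * t)) = e * e by rewrite -expRD; congr expR; field.
have ey : expR (- (y * t)) = expR (- (x * t)) * expR (- ((y - x) * t)).
  by rewrite -expRD; congr expR; ring.
have h1 := expR_ge1Dx (- ((y - x) * t)).
have h2 : x / 2 * t * e <= 1.
  rewrite /e expRN ler_pdivrMr ?expR_gt0// mul1r.
  by apply: le_trans (expR_ge1Dx _); rewrite lerDr.
have h3 : t * e <= 2 / x.
  rewrite ler_pdivlMr//; move: h2; lra.
rewrite ey ex -/e.
have : e * e * (1 - (y - x) * t) <= e * e * expR (- ((y - x) * t)).
  by rewrite ler_wpM2l// mulr_ge0// ltW.
have : (y - x) * e * (t * e) <= (y - x) * e * (2 / x).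
  by rewrite ler_wpM2l// mulr_ge0 ?subr_ge0// ltW.
lra.
Qed.

Lemma theta_expR_continuous x : 0 < x ->
  {for x, continuous (fun z : R => theta (expR (- z)))}.
Proof.
move=> x0; apply/cvgrPdist_le => eps eps0.
(* This is the constant of [theta_expR_lipschitz] at [x / 2]; it serves for every left endpoint from
   [x / 2] on. *)
pose C := 4 / x * theta (expR (- (x / 4))).
have x40 : 0 < x / 4 by rewrite divr_gt0.
have th1 (z : R) : 0 < z -> 1 <= theta (expR (- z)).
  move=> z0; have := theta_gt1 (expRN_in01 z0).
  by have := expR_ge0 (- z); lra.
have C0 : 0 < C.
  by rewrite mulr_gt0 ?divr_gt0// (lt_le_trans ltr01)// th1.
have lip (a b : R) : x / 2 <= a -> a <= b ->
    `|theta (expR (- a)) - theta (expR (- b))| <= (b - a) * C.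
  move=> xa ab; have a0 : 0 < a by lra.
  rewrite ger0_norm ?subr_ge0 ?theta_expR_anti//.
  apply: (le_trans (theta_expR_lipschitz a0 ab)).
  rewrite ler_wpM2l ?subr_ge0// /C ler_pM ?divr_ge0//.
  - exact: ltW.
  - by apply: (le_trans ler01 (th1 _ _)); rewrite divr_gt0.
  - by rewrite ler_pdivrMr// mulrAC ler_pdivlMr//; lra.
  - by apply: theta_expR_anti => //; lra.
near=> y.
have y_ge : x / 2 < y by near: y; apply: lt_nbhsr; lra.
have yx : `|x - y| * C <= eps.
  rewrite -ler_pdivlMr//; near: y.
  by apply: filterS (nbhsx_ballx x (eps / C) (divr_gt0 eps0 C0)) => z /ltW.
have [xy|/ltW yx'] := leP x y.
- apply: le_trans yx; rewrite [`|x - y|]distrC (ger0_norm (_ : 0 <= y - x)) ?subr_ge0//.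
  by apply: lip => //; lra.
- rewrite distrC; apply: le_trans yx; rewrite (ger0_norm (_ : 0 <= x - y)) ?subr_ge0//.
  by apply: lip => //; exact: ltW.
Unshelve. all: by end_near. Qed.

End theta_exponential.

(** * Bounds on theta by the Gauss integral *)

Section gaussian_bounds.
Variable R : realType.

Lemma theta_gauss_lower (a : R) : 0 < a ->
  Num.sqrt pi / 2 / Num.sqrt a < theta (expR (- (2 * a))).
Proof.
move=> a0; have a20 : 0 < 2 * a by rewrite mulr_gt0.
have sa0 : 0 < Num.sqrt a by rewrite sqrtr_gt0.
(* For a > 4/5 the left-hand side is below 1, the first term of theta. *)
have [a1|a1] := leP a (4 / 5); last first.
  apply: (@le_lt_trans _ _ 1).
    rewrite ler_pdivrMr// mul1r ler_pdivrMr//.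
    have -> : 2 = Num.sqrt 4 :> R.
      by rewrite (_ : 4 = 2 ^+ 2) ?sqrtr_sqr ?ger0_norm// -natrX.
    rewrite -sqrtrM ?(ltW a0)// ler_wsqrtr//; have := pi_le R; lra.
  have := theta_gt1 (expRN_in01 a20); have := expR_gt0 (- (2 * a)); lra.
have [E [dE E0 Ey]] := gauss_primitive R.
have [|d d0 Ed] := @gauss_sum_lower R E dE E0 a; first by rewrite a0 a1.
rewrite ltr_pdivrMr//; apply: (@lt_le_trans _ _ (Num.sqrt pi / 2 + d)).
  by rewrite ltrDl.
have cvE : E (n%:R * Num.sqrt a) @[n --> \oo] --> Num.sqrt pi / 2.
  move/cvg_pinftyP : Ey; apply.
  apply/cvgryPge => M; apply: filterS (nbhs_infty_ger (M / Num.sqrt a)) => n.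
  by rewrite ler_pdivrMr.
rewrite -lerBrDr; apply: (cvgr_to_le cvE).
near=> n; have /prednK <- : (0 < n)%N by near: n; exists 1%N.
rewrite lerBrDr (le_trans (Ed _))// mulrC ler_wpM2r ?sqrtr_ge0//.
apply: le_trans (theta_ge_partial n.-1.+1 _).
  by apply: ler_sum => j _; rewrite expRX_pronic.
by have /andP[/ltW -> ->] := expRN_in01 a20.
Unshelve. all: by end_near. Qed.

(** After n (n + 1) is weakened to n^2, the terms with n >= 1 form a right-endpoint Riemann sum of a
    decreasing function, hence below the Gauss integral; the term n = 0 gives the 1. *)
Lemma theta_gauss_upper (a : R) : 0 < a ->
  theta (expR (- (2 * a))) <= 1 + Num.sqrt pi / 2 / Num.sqrt a.
Proof.
move=> a0; have a20 : 0 < 2 * a by rewrite mulr_gt0.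
have sa0 : 0 < Num.sqrt a by rewrite sqrtr_gt0.
have ss : Num.sqrt a ^+ 2 = a by rewrite sqr_sqrtr// ltW.
have [E [dE E0 Ey]] := gauss_primitive R.
have E_homo x y : x <= y -> E x <= E y.
  move=> xy; apply: (@derive_ge0_le R E _ x y xy (fun z _ => dE z)) => z _.
  exact: expR_ge0.
have E_le x : E x <= Num.sqrt pi / 2.
  apply: (cvgr_to_ge Ey); near=> y; apply: E_homo.
  by near: y; apply: nbhs_pinfty_ge; exact: num_real.
have E_step x y : 0 <= x -> x <= y -> (y - x) * expR (- y ^+ 2) <= E y - E x.
  move=> x0 xy; pose c := expR (- y ^+ 2).
  have dG (z : R) : is_derive z 1 (E - (c \*: id)) (expR (- z ^+ 2) - c *: 1).
    exact: is_deriveB.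
  have := @derive_ge0_le R (E - (c \*: id)) _ x y xy (fun z _ => dG z).
  have ge0 z : x < z < y -> 0 <= expR (- z ^+ 2) - c *: 1.
    move=> /andP[xz zy]; rewrite /GRing.scale/= mulr1 subr_ge0 ler_expR lerN2.
    by rewrite ler_pXn2r ?nnegrE//; lra.
  move=> /(_ ge0).
  have -> : (E - c \*: id) x = E x - c * x by [].
  have -> : (E - c \*: id) y = E y - c * y by [].
  rewrite -/c; lra.
apply: theta_le_bound => [|n].
  by have /andP[/ltW -> ->] := expRN_in01 a20.
under eq_bigr do rewrite expRX_pronic.
rewrite -(ler_pM2l sa0) mulrDr mulr1 [_ * (_ / _)]mulrC divfK ?gt_eqF//.
case: n => [|n].
  by rewrite big_ord0 mulr0 addr_ge0 ?divr_ge0 ?sqrtr_ge0.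
apply: (@le_trans _ _ (Num.sqrt a + E (n%:R * Num.sqrt a))); last first.
  by rewrite lerD2l E_le.
elim: n => [|n IH].
  rewrite big_ord_recr big_ord0/= add0r /pronic_expR !(mul0r, mulr0) oppr0 expR0.
  by rewrite mulr1 E0 addr0.
have := E_step (n%:R * Num.sqrt a) (n.+1%:R * Num.sqrt a).
rewrite -mulrBl -natrB// subSnn mul1r mulr_ge0 ?(ltW sa0)//.
rewrite ler_pM2r// ler_nat leqnSn => /(_ isT isT).
rewrite exprMn ss => step.
rewrite big_ord_recr/= mulrDr.
have : Num.sqrt a * pronic_expR a n.+1%:R <=
       Num.sqrt a * expR (- (n.+1%:R ^+ 2 * a)).
  rewrite ler_pM2l// ler_expR lerN2 [leLHS]mulrC ler_pM2l//.
  have := ler0n R n.+1; nra.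
by move: IH step; lra.
Unshelve. all: by end_near. Qed.

End gaussian_bounds.

(** * Existence of the maximum of (1 - t) theta(t^gamma) *)

Section theta_values_maximum.
Variables (R : realType) (gamma : R).
Hypothesis gamma01 : 0 < gamma < 1.

Let g0 : 0 < gamma. Proof. by case/andP: gamma01. Qed.
Let g1 : gamma < 1. Proof. by case/andP: gamma01. Qed.

Let F (u : R) : R := (1 - expR (- u)) * theta (expR (- (gamma * u))).

Let gu_gt0 (u : R) : 0 < u -> 0 < gamma * u.
Proof. by move=> u0; rewrite mulr_gt0. Qed.

Lemma theta_valuesE : theta_values gamma =
  [set (1 - expR (- u)) * theta (expR (- (gamma * u))) | u in `]0, +oo[].
Proof.
apply/seteqP; split => [_ [t /= + <-]|_ [u /= + <-]]; rewrite in_itv/=.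
- move=> /andP[t0 t1]; exists (- ln t).
    by rewrite /= in_itv/= andbT oppr_gt0 ln_lt0// t0.
  by rewrite mulrN !opprK [gamma * _]mulrC expRM lnK ?posrE.
- rewrite andbT => u0; exists (expR (- u)).
    by rewrite /= in_itv/= expRN_in01.
  by rewrite -expRM mulNr [u * _]mulrC.
Qed.

Let one_sub_expRN (u : R) : 0 < u -> 0 < 1 - expR (- u) <= 1.
Proof.
move=> /expRN_in01/andP[e0 e1]; lra.
Qed.

Let F_le_near0 : exists2 e : R, 0 < e & forall u, 0 < u <= e -> F u <= 1.
Proof.
pose K : R := Num.sqrt pi / 2 / Num.sqrt (gamma / 2).
have K0 : 0 <= K by rewrite !divr_ge0 ?sqrtr_ge0.
(* For sqrt u <= s <= 1/2, the bound u + K sqrt u on [F u] is at most s (K + 1) = 1/2. *)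
pose s := (2 * (K + 1))^-1.
have s0 : 0 < s by rewrite invr_gt0; lra.
have sK : s * (K + 1) = 1 / 2 by rewrite /s; field; lra.
exists (s ^+ 2); first by rewrite exprn_gt0.
move=> u /andP[u0 us].
have ru0 : 0 < Num.sqrt u by rewrite sqrtr_gt0.
have ru : Num.sqrt u <= s by rewrite -(ger0_norm (ltW s0)) -sqrtr_sqr ler_wsqrtr.
have uu : u = Num.sqrt u * Num.sqrt u by rewrite -expr2 sqr_sqrtr// ltW.
have a0 : 0 < gamma / 2 * u by rewrite mulr_gt0// divr_gt0.
have th : theta (expR (- (gamma * u))) <= 1 + K / Num.sqrt u.
  have -> : gamma * u = 2 * (gamma / 2 * u) by field.
  apply: (le_trans (theta_gauss_upper a0)).
  by rewrite sqrtrM ?divr_ge0 ?(ltW g0)// invfM mulrA.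
have := one_sub_expRN u0; move=> /andP[e0 _].
have eu : 1 - expR (- u) <= u by have := expR_ge1Dx (- u); lra.
apply: (@le_trans _ _ (u * (1 + K / Num.sqrt u))).
  apply: ler_pM => //; first exact: ltW.
  by apply: (le_trans ler01); have := theta_gt1 (expRN_in01 (gu_gt0 u0));
    have := expR_ge0 (- (gamma * u)); lra.
have -> : u * (1 + K / Num.sqrt u) = u + K * Num.sqrt u.
  rewrite mulrDr mulr1 mulrCA; congr (_ + K * _).
  by rewrite {1}uu mulfK ?gt_eqF.
rewrite {1}uu; nra.
Qed.

Let F_gt1 : exists2 u : R, 0 < u & 1 < F u.
Proof.
(* This choice gives exp(-u) = g exp(-2) with g = exp(-gamma u), so (1 - exp(-u)) (1 + g) = 1 + g (1
   - exp(-2) - exp(-u)) exceeds 1. *)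
pose u := 2 / (1 - gamma).
have u_ge2 : 2 <= u by rewrite ler_pdivlMr ?subr_gt0//; have := g0; lra.
have u0 : 0 < u by lra.
exists u => //.
apply: (@lt_le_trans _ _ ((1 - expR (- u)) * (1 + expR (- (gamma * u))))); last first.
  by rewrite ler_wpM2l ?theta_gt1 ?expRN_in01 ?gu_gt0//;
    case/andP: (one_sub_expRN u0) => /ltW.
have e2 : expR (- 2) <= 1 / 3 :> R.
  rewrite expRN -[leRHS]invrK lef_pV2 ?posrE ?expR_gt0//.
  by have := expR_ge1Dx (2 : R); rewrite invf_div; lra.
have eu : expR (- u) <= 1 / 3.
  by apply: le_trans e2; rewrite ler_expR; lra.
have eg : expR (- u) = expR (- (gamma * u)) * expR (- 2).
  rewrite -expRD; congr expR; rewrite /u; field.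
  by rewrite subr_eq0 gt_eqF.
have g := expR_gt0 (- (gamma * u)).
have ke : 0 < 1 - expR (- 2) - expR (- u) by lra.
have := mulr_gt0 g ke; lra.
Qed.

Let F_le_far (M : R) : 1 < M -> exists2 U : R, 0 < U &
  forall u, U <= u -> F u <= M.
Proof.
(* With v = gamma u, the geometric bound 1 / (1 - exp(-v)) is at most 1 + 1 / v, and v >= 1 / (M -
   1) from [U] on. *)
move=> M1; pose U := (gamma * (M - 1))^-1.
have U0 : 0 < U by rewrite invr_gt0 mulr_gt0// subr_gt0.
exists U => // u Uu; have u0 : 0 < u by exact: lt_le_trans Uu.
have gu := gu_gt0 u0.
have /andP[e0 e1] := expRN_in01 gu.
apply: (@le_trans _ _ (theta (expR (- (gamma * u))))).
  rewrite ger_pMl; first by case/andP: (one_sub_expRN u0).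
  by have := theta_gt1 (expRN_in01 gu); lra.
apply: (le_trans (theta_le_geometric _)); first by rewrite ltW.
have gM : 1 <= gamma * u * (M - 1).
  have : U * (gamma * (M - 1)) <= u * (gamma * (M - 1)).
    by rewrite ler_pM2r// mulr_gt0// subr_gt0.
  by rewrite /U mulVf ?gt_eqF ?mulr_gt0 ?subr_gt0//; lra.
have eg : expR (- (gamma * u)) * (1 + gamma * u) <= 1.
  rewrite expRN mulrC ler_pdivrMr ?expR_gt0// mul1r; exact: expR_ge1Dx.
rewrite -[leLHS]div1r ler_pdivrMr ?subr_gt0//; nra.
Qed.

Let F_continuous (u : R) : 0 < u -> {for u, continuous F}.
Proof.
move=> u0; apply: cvgM.
  apply: cvgB; first exact: cvg_cst.
  apply: (@continuous_comp _ _ _ (fun x : R => - x) expR).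
    exact: opp_continuous.
  exact: continuous_expR.
apply: (@continuous_comp _ _ _ (fun x : R => gamma * x)
  (fun z : R => theta (expR (- z)))).
  by apply: cvgM; [exact: cvg_cst|exact: cvg_id].
exact/theta_expR_continuous/gu_gt0.
Qed.

(** Near 0 and far out, [F] stays at or below its value at [u1], which exceeds 1; a compact interval
    stretched to contain [u1] therefore captures the maximum. *)
Lemma theta_values_has_maximum : has_maximum (theta_values gamma).
Proof.
have [e e0 Fe] := F_le_near0; have [u1 u10 Fu1] := F_gt1.
have [U U0 FU] := F_le_far Fu1.
pose A := Num.min e u1; pose B := Num.max U u1.
have A0 : 0 < A by rewrite lt_min e0.
have u1AB : u1 \in `[A, B] by rewrite in_itv/= ge_min le_max !lexx !orbT.
have AB : A <= B by move: u1AB; rewrite in_itv/= => /andP[]; exact: le_trans.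
have [|c cAB Fc] := @EVT_max R F A B AB.
  apply: continuous_in_subspaceT => x; rewrite inE/= in_itv/= => /andP[Ax _].
  by apply: F_continuous; exact: lt_le_trans Ax.
exists (F c); rewrite theta_valuesE; split.
  exists c => //; move: cAB; rewrite in_itv/= => /andP[Ac _].
  by rewrite /= in_itv/= andbT; exact: lt_le_trans Ac.
move=> _ [u /= + <-]; rewrite in_itv/= andbT => u0; rewrite -/(F u).
have Fcu1 : F u1 <= F c := Fc _ u1AB.
have [uA|Au] := leP u A.
  apply: (le_trans (Fe _ _)); last by apply: ltW; exact: lt_le_trans Fcu1.
  by rewrite u0 (le_trans uA)// ge_min lexx.
have [uB|Bu] := leP u B; first by apply: Fc; rewrite in_itv/= (ltW Au).
apply: le_trans Fcu1; apply: FU; apply: le_trans (ltW Bu).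
by rewrite le_max lexx.
Qed.

End theta_values_maximum.

(** * Evaluation at the critical point *)

Theorem theorem4p5 (R : realType) :
  [/\ has_maximum (chi_values R),
      decimal R [:: 7; 9; 9; 8; 3; 0; 8; 4; 9; 8]%N <= Gamma_chi R
        < decimal R [:: 7; 9; 9; 8; 3; 0; 8; 4; 9; 9]%N
    & forall gamma : R, 0 < gamma < 1 ->
        has_maximum (theta_values gamma) /\
        maximum (theta_values gamma) > Gamma_chi R * Num.sqrt (1 / gamma)].
Proof.
have [u [u0 expR_u Gamma_itv]] := critical_point R.
have su0 : 0 < Num.sqrt u by rewrite sqrtr_gt0.
have uu : Num.sqrt u * Num.sqrt u = u by rewrite -expr2 sqr_sqrtr// ltW.
have chi_max := chi_maximum u0 expR_u.
have pi2 : 0 <= pi / 2 :> R by rewrite divr_ge0// pi_ge0.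
have GammaE : Gamma_chi R =
    Num.sqrt (pi / 2) * ((1 - expR (- u)) / Num.sqrt u).
  by rewrite /Gamma_chi (maximumE chi_max).
(* At the critical point 1 - exp(-u) = 2 u / (1 + 2 u). *)
have Gamma_u : Gamma_chi R = Num.sqrt (4 * (pi / 2) * u) / (1 + 2 * u).
  rewrite GammaE expRN expR_u (sqrtrM u (mulr_ge0 (ler0n R 4) pi2)).
  rewrite (sqrtrM (pi / 2) (ler0n R 4)).
  have -> : Num.sqrt 4 = 2 :> R.
    by rewrite (_ : 4 = 2 ^+ 2) ?sqrtr_sqr ?ger0_norm// -natrX.
  have gen (P s : R) : 0 < s ->
      P * ((1 - (1 + 2 * (s * s))^-1) / s) = 2 * P * s / (1 + 2 * (s * s)).
    by move=> s0; field; rewrite !gt_eqF//; nra.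
  by have := gen (Num.sqrt (pi / 2)) _ su0; rewrite uu.
have u12 : 0 < 1 + 2 * u by lra.
split.
- by exists ((1 - expR (- u)) / Num.sqrt u).
- by rewrite Gamma_u ler_pdivlMr// ltr_pdivrMr.
move=> gamma /[dup] g01 /andP[g0 g1]; have := theta_values_has_maximum g01.
move=> /[dup] hm [M Mmax]; split => //; rewrite (maximumE Mmax).
have gu0 : 0 < gamma / 2 * u by rewrite mulr_gt0// divr_gt0.
apply: (@lt_le_trans _ _ ((1 - expR (- u)) * theta (expR (- (gamma * u))))).
  have -> : gamma * u = 2 * (gamma / 2 * u) by field.
  (* With a = gamma u / 2, sqrt(pi) / (2 sqrt a) equals sqrt(pi / 2) / sqrt(gamma u), so both sides
     share the factor 1 - exp(-u). *)
  have -> : Gamma_chi R * Num.sqrt (1 / gamma) =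
      (1 - expR (- u)) * (Num.sqrt pi / 2 / Num.sqrt (gamma / 2 * u)).
    have q0 : 0 < Num.sqrt (2^-1) :> R by rewrite sqrtr_gt0.
    have qq : Num.sqrt (2^-1) * Num.sqrt (2^-1) = 2^-1 :> R.
      by rewrite -expr2 sqr_sqrtr.
    have sg0 : 0 < Num.sqrt gamma by rewrite sqrtr_gt0.
    rewrite GammaE div1r sqrtrV ?(ltW g0)// sqrtrM ?pi_ge0//.
    rewrite (sqrtrM u) ?divr_ge0 ?(ltW g0)// (sqrtrM _ (ltW g0)).
    have -> : Num.sqrt pi / 2 =
      Num.sqrt pi * (Num.sqrt (2^-1) * Num.sqrt (2^-1)) :> R by rewrite qq.
    by field; rewrite !gt_eqF.
  rewrite ltr_pM2l; first exact: theta_gauss_lower.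
  by rewrite subr_gt0 expR_lt1 oppr_lt0.
case: Mmax => _; apply; rewrite theta_valuesE//.
by exists u => //; rewrite /= in_itv/= u0.
Qed.
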